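(* Let $u_h\in S_h$ be a $P1$-conforming finite element approximation, i.e. $u_h=I_hg$ on $\partial\Omega$ and $\mathfrak{Q}(u_h;u_h,v)=F(v)$ for all $v\in S_h^0$. Let $f\le0$ be a locally integrable function on $\Omega$, and let the following ellipticity and boundedness conditions hold with constants $\lambda>0$, $\Lambda$, $\nu\ge0$: for all $x\in\Omega$, $\eta\in\mathbb{R}$, $q\in\mathbb{R}^d$, $$a(x,\eta,q)\ge\lambda,\qquad |a(x,\eta,q)|\le\Lambda,\qquad \lambda^{-2}\sum_i|b_i(x,\eta,q)|^2+\lambda^{-2}|c(x,\eta)|^2\le\nu^2 .$$ Assume that either $c\ge 0$ or $c\equiv 0$, let $k_*$ be the corresponding number defined in the context, and assume that $$\mathfrak{Q}(u_h;(u_h-k)_-,(u_h-k)_+)\ge 0\qquad\text{for every real } k\ge k_*.$$ Then $$\sup_{x\in\Omega}u_h(x)\le\begin{cases}\sup_{x\in\partial\Omega}\max(I_hg(x),0), & \text{if } c\ge0,\\ \sup_{x\in\partial\Omega}I_hg(x), & \text{if } c\equiv0,\end{cases}$$ provided that the meshsize $h$ is sufficiently small such that $h\nu<1$.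
   Context: Setting. $\Omega\subset\mathbb{R}^d$ ($d=2,3$) is a (bounded) polygonal or polyhedral domain. The continuous problem is the quasi-linear equation $-\nabla\cdot(a(x,u,\nabla u)\nabla u)+\mathbf{b}(x,u,\nabla u)\cdot\nabla u+c(x,u)u=f(x)$ in $\Omega$ with $u=g$ on $\partial\Omega$, where $a$ and $c$ are scalar functions and $\mathbf{b}=(b_i)$ is $\mathbb{R}^d$-valued. ''$c\ge0$'' means $c(x,\eta)\ge0$ for all $x\in\Omega$, $\eta\in\mathbb{R}$. Forms. $\mathfrak{Q}(w;u,v):=\int_\Omega\{a\nabla u\cdot\nabla v+(\mathbf{b}\cdot\nabla u)v+cuv\}\,dx$ with $a=a(x,w,\nabla w)$, $\mathbf{b}=\mathbf{b}(x,w,\nabla w)$, $c=c(x,w)$; and $F(v)=\int_\Omega fv\,dx$ (understood to be well defined for $v\in S_h^0$). Finite elements. $\mathcal{T}_h$ is a shape-regular finite element partition of $\Omega$ into triangles ($d=2$) or tetrahedra ($d=3$), $h=\max_{T\in\mathcal{T}_h}h_T$ with $h_T$ the diameter of $T$. $S_h=\{v\in H^1(\Omega): v|_T\in P_1(T)\ \forall T\in\mathcal{T}_h\}$ (continuous piecewise linear functions), $S_h^0=\{v\in S_h: v|_{\partial\Omega}=0\}$. $I_hg$ is a given continuous piecewise linear function on $\partial\Omega$ interpolating the Dirichlet data $g$. Nodal positive and negative parts. For $v\in S_h$ and $k\in\mathbb{R}$, $(v-k)_+\in S_h$ is the function whose value at each nodal point (vertex) $A$ of $\mathcal{T}_h$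 is $v(A)-k$ if $v(A)\ge k$ and $0$ otherwise; $(v-k)_-:=(v-k)-(v-k)_+$. The number $k_*$. $k_*=\sup_{x\in\partial\Omega}\max\{I_hg(x),0\}$ if $c\ge0$, and $k_*=\sup_{x\in\partial\Omega}I_hg(x)$ if $c\equiv0$. *)

(* Defs.v *)
From HB Require Import structures.
From mathcomp Require Import all_boot all_order all_algebra.
From mathcomp Require Import all_classical all_reals all_analysis.

Set Implicit Arguments.
Unset Strict Implicit.
Unset Printing Implicit Defensive.

Import Order.TTheory GRing.Theory Num.Theory.
Import numFieldNormedType.Exports.

Local Open Scope classical_set_scope.
Local Open Scope ring_scope.

(* The library has Lebesgue measure on R and binary products only.  The Borel
   version on n.-tuple R is obtained by iterating the product measure. *)
Section tuple_lebesgue.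
Context (R : realType).

Definition tuple_cons n (p : measurableTypeR R * n.-tuple (measurableTypeR R)) :
  n.+1.-tuple (measurableTypeR R) := [the n.+1.-tuple _ of p.1 :: p.2].

Definition tuple_uncons n (t : n.+1.-tuple (measurableTypeR R)) :
  measurableTypeR R * n.-tuple (measurableTypeR R) :=
  (thead t, [tuple of behead t]).

Lemma measurable_tuple_cons n : measurable_fun setT (@tuple_cons n).
Proof. by apply: measurable_cons; [exact: measurable_fst|exact: measurable_snd]. Qed.

HB.instance Definition _ n :=
  isMeasurableFun.Build _ _ _ _ (@tuple_cons n) (@measurable_tuple_cons n).

Lemma measurable_tuple_uncons n : measurable_fun setT (@tuple_uncons n).
Proof.
apply/measurable_fun_pairP; split.
  exact: measurable_tnth.
exact: measurable_behead.
Qed.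

Lemma tuple_consK n : cancel (@tuple_cons n) (@tuple_uncons n).
Proof. by case=> x t; rewrite /tuple_uncons theadE; congr pair; exact: val_inj. Qed.

Section step.
Context (n : nat).
Variables (m1 : {sigma_finite_measure set (measurableTypeR R) -> \bar R})
  (mu : {sigma_finite_measure set (n.-tuple (measurableTypeR R)) -> \bar R}).

Definition tuple_lebesgueS : set (n.+1.-tuple (measurableTypeR R)) -> \bar R :=
  pushforward (m1 \x mu)%E (@tuple_cons n).

Let tuple_lebesgueS0 : tuple_lebesgueS set0 = 0%E.
Proof. exact: measure0. Qed.

Let tuple_lebesgueS_ge0 A : (0 <= tuple_lebesgueS A)%E.
Proof. exact: measure_ge0. Qed.

Let tuple_lebesgueS_sigma_additive : semi_sigma_additive tuple_lebesgueS.
Proof. exact: measure_semi_sigma_additive. Qed.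

HB.instance Definition _ := isMeasure.Build _ _ _ tuple_lebesgueS
  tuple_lebesgueS0 tuple_lebesgueS_ge0 tuple_lebesgueS_sigma_additive.

Lemma tuple_lebesgueS_sigma_finite : sigma_finite setT tuple_lebesgueS.
Proof.
have [F FT mF] : sigma_finite setT (m1 \x mu)%E.
  have /sigma_finiteP[F [TF ndF Foo]] := sigma_finiteT m1.
  have /sigma_finiteP[G [TG ndG Goo]] := sigma_finiteT mu.
  exists (fun k => F k `*` G k).
    rewrite -setXTT TF TG predeqE => -[x y]; split.
      move=> [/= [i _ Fix] [j _ Gjy]]; exists (maxn i j) => //; split.
      - by move: x Fix; exact/subsetPset/ndF/leq_maxl.
      - by move: y Gjy; exact/subsetPset/ndG/leq_maxr.
    by move=> [i _ []/= ? ?]; split; exists i.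
  move=> k; have [? ?] := Foo k; have [? ?] := Goo k.
  split; first exact: measurableX.
  by rewrite product_measure1E// lte_mul_pinfty// ge0_fin_numE.
exists (fun k => @tuple_uncons n @^-1` F k); first by rewrite -preimage_bigcup -FT.
move=> k; have [mFk Fkoo] := mF k; split.
  by rewrite -[X in measurable X]setTI; exact: measurable_tuple_uncons.
rewrite /tuple_lebesgueS /pushforward -comp_preimage.
by rewrite (_ : _ \o _ = id) //; apply/funext => p; exact: tuple_consK.
Qed.

HB.instance Definition _ :=
  Measure_isSigmaFinite.Build _ _ _ tuple_lebesgueS tuple_lebesgueS_sigma_finite.

End step.

Fixpoint tuple_lebesgue n :
    {sigma_finite_measure set (n.-tuple (measurableTypeR R)) -> \bar R} :=
  if n is m.+1 then tuple_lebesgueS (@lebesgue_measure R) (tuple_lebesgue m)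
  else dirac ([tuple] : 0.-tuple (measurableTypeR R)).

Definition row_of_tuple d (t : d.-tuple (measurableTypeR R)) : 'rV[R]_d :=
  \row_i tnth t i.

Definition lebesgue_outer d (X : set 'rV[R]_d) : \bar R :=
  ((tuple_lebesgue d)^*)%mu (@row_of_tuple d @^-1` X).

Lemma lebesgue_outer0 d : @lebesgue_outer d set0 = 0%E.
Proof. by rewrite /lebesgue_outer preimage_set0 outer_measure0. Qed.

Lemma lebesgue_outer_ge0 d X : (0 <= @lebesgue_outer d X)%E.
Proof. exact: outer_measure_ge0. Qed.

Lemma le_lebesgue_outer d : {homo @lebesgue_outer d : A B / A `<=` B >-> (A <= B)%E}.
Proof. by move=> A B AB; apply: le_outer_measure; exact: preimage_subset. Qed.

Lemma lebesgue_outer_sigma_subadditive d : sigma_subadditive (@lebesgue_outer d).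
Proof.
move=> F; rewrite /lebesgue_outer preimage_bigcup.
exact: outer_measure_sigma_subadditive.
Qed.

HB.instance Definition _ d := isOuterMeasure.Build R 'rV[R]_d (@lebesgue_outer d)
  (@lebesgue_outer0 d) (@lebesgue_outer_ge0 d) (@le_lebesgue_outer d)
  (@lebesgue_outer_sigma_subadditive d).

(* The sigma-algebra here consists of the Lebesgue (Caratheodory) measurable
   sets, so that lebesgue_Rd is complete. *)
Definition Rd_leb d := caratheodory_type (@lebesgue_outer d).

HB.instance Definition _ d := Pointed.on (Rd_leb d).
HB.instance Definition _ d := Measurable.on (Rd_leb d).

Definition lebesgue_Rd d : set (Rd_leb d) -> \bar R := @lebesgue_outer d.

HB.instance Definition _ d := isMeasure.Build _ _ _ (@lebesgue_Rd d)
  (@caratheodory_measure0 _ _ (@lebesgue_outer d))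
  (@caratheodory_measure_ge0 _ _ (@lebesgue_outer d))
  (@caratheodory_measure_sigma_additive _ _ (@lebesgue_outer d)).

End tuple_lebesgue.

Section geometry.
Context (R : realType) (d : nat).
Implicit Types (Omega A : set 'rV[R]_d) (p : 'I_d.+1 -> 'rV[R]_d).

Definition vdot (u v : 'rV[R]_d) : R := \sum_i u ord0 i * v ord0 i.

(* The library's norm on row vectors is the maximum norm. *)
Definition enorm (u : 'rV[R]_d) : R := Num.sqrt (vdot u u).

Definition ediam A : R :=
  sup [set r | exists x y, [/\ A x, A y & r = enorm (x - y)]].

Definition boundary Omega := closure Omega `\` interior Omega.

Definition bounded_domain Omega :=
  [/\ open Omega, connected Omega, Omega !=set0 & bounded_set Omega].

(* The face of the simplex with vertices p spanned by the vertices in I. *)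
Definition face p (I : {set 'I_d.+1}) : set 'rV[R]_d :=
  [set x | exists l : 'I_d.+1 -> R,
    [/\ forall i, 0 <= l i, forall i, i \notin I -> l i = 0,
        \sum_i l i = 1 & x = \sum_i l i *: p i]].

Definition simplex p : set 'rV[R]_d := face p [set: 'I_d.+1]%SET.

Definition affinely_independent p :=
  forall l : 'I_d.+1 -> R, \sum_i l i = 0 -> \sum_i l i *: p i = 0 ->
  forall i, l i = 0.

Record mesh := Mesh {
  nelt : nat;
  vertex : 'I_nelt -> 'I_d.+1 -> 'rV[R]_d }.

Definition elem (M : mesh) (K : 'I_(nelt M)) := simplex (vertex K).

Definition nodes (M : mesh) : set 'rV[R]_d :=
  [set z | exists (K : 'I_(nelt M)) i, z = vertex K i].

Definition meshsize (M : mesh) : R :=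
  \big[Num.max/0]_(K < nelt M) ediam (elem K).

(* Together with bounded_domain Omega, the existence of such a partition says
   that Omega is polygonal (d = 2) or polyhedral (d = 3). *)
Record fe_partition Omega (M : mesh) : Prop := FEPartition {
  fe_nondegenerate : forall K : 'I_(nelt M), affinely_independent (vertex K);
  fe_cover : closure Omega = \bigcup_(K : 'I_(nelt M)) elem K;
  fe_conforming : forall K L : 'I_(nelt M), K != L ->
    exists I J : {set 'I_d.+1},
      [/\ I \proper [set: 'I_d.+1]%SET, J \proper [set: 'I_d.+1]%SET,
          elem K `&` elem L = face (vertex K) I &
          elem K `&` elem L = face (vertex L) J];
  fe_boundary : forall x, boundary Omega x ->
    exists (K : 'I_(nelt M)) (I : {set 'I_d.+1}),
      face (vertex K) I x /\ face (vertex K) I `<=` boundary Omega }.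

Definition shape_regular (sigma : R) (M : mesh) :=
  forall K : 'I_(nelt M), exists (x : 'rV[R]_d) (rho : R),
    [/\ 0 < rho, [set y | enorm (y - x) <= rho] `<=` elem K &
        ediam (elem K) <= sigma * rho].

Definition affine_on A (v : 'rV[R]_d -> R) :=
  exists (q : 'rV[R]_d) (r : R), forall x, A x -> v x = vdot q x + r.

(* Finite element functions are total functions; only their values on
   closure Omega matter.  For piecewise affine functions, continuity on
   closure Omega is membership in H^1(Omega). *)
Definition P1space Omega (M : mesh) : set ('rV[R]_d -> R) :=
  [set v | {within closure Omega, continuous v} /\
           forall K : 'I_(nelt M), affine_on (elem K) v].

Definition P1space0 Omega (M : mesh) : set ('rV[R]_d -> R) :=
  [set v | P1space Omega M v /\ forall x, boundary Omega x -> v x = 0].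

Definition boundary_interpolant Omega (M : mesh) (g gh : 'rV[R]_d -> R) :=
  [/\ {within boundary Omega, continuous gh},
      forall (K : 'I_(nelt M)) (I : {set 'I_d.+1}),
        face (vertex K) I `<=` boundary Omega -> affine_on (face (vertex K) I) gh &
      forall z, nodes M z -> boundary Omega z -> gh z = g z].

(* nodal_pos Omega M v k is (v - k)_+ and nodal_neg Omega M v k is (v - k)_-;
   the former is determined on closure Omega by its nodal values. *)
Definition nodal_pos Omega (M : mesh) (v : 'rV[R]_d -> R) (k : R) :
    'rV[R]_d -> R :=
  xget (fun=> 0) [set w | P1space Omega M w /\
    forall z, nodes M z -> w z = if k <= v z then v z - k else 0].

Definition nodal_neg Omega (M : mesh) (v : 'rV[R]_d -> R) (k : R) :
    'rV[R]_d -> R :=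
  fun x => (v x - k) - nodal_pos Omega M v k x.

(* For a finite element function this is the elementwise constant gradient on
   the interiors of the elements, i.e. the weak gradient almost everywhere. *)
Definition grad (v : 'rV[R]_d -> R) (x : 'rV[R]_d) : 'rV[R]_d :=
  \row_i 'D_(delta_mx ord0 i) v x.

Definition formQ Omega (a : 'rV[R]_d -> R -> 'rV[R]_d -> R)
    (b : 'rV[R]_d -> R -> 'rV[R]_d -> 'rV[R]_d) (c : 'rV[R]_d -> R -> R)
    (w u v : 'rV[R]_d -> R) : R :=
  \int[@lebesgue_Rd R d]_(x in Omega)
    (a x (w x) (grad w x) * vdot (grad u x) (grad v x)
     + vdot (b x (w x) (grad w x)) (grad u x) * v x
     + c x (w x) * u x * v x).

Definition formF Omega (f v : 'rV[R]_d -> R) : R :=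
  \int[@lebesgue_Rd R d]_(x in Omega) (f x * v x).

Definition Rd_measurable_fun Omega (f : 'rV[R]_d -> R) :=
  measurable_fun (Omega : set (Rd_leb R d)) (f : Rd_leb R d -> measurableTypeR R).

Definition Rd_integrable Omega (f : 'rV[R]_d -> R) :=
  (@lebesgue_Rd R d).-integrable Omega (EFin \o f).

Definition Rd_locally_integrable Omega (f : 'rV[R]_d -> R) :=
  Rd_measurable_fun Omega f /\
  forall C, compact C -> C `<=` Omega -> Rd_integrable C f.

(* The measurability implicit in the formation of formQ Omega a b c w u v. *)
Definition measurable_coefficients Omega (a : 'rV[R]_d -> R -> 'rV[R]_d -> R)
    (b : 'rV[R]_d -> R -> 'rV[R]_d -> 'rV[R]_d) (c : 'rV[R]_d -> R -> R)
    (w : 'rV[R]_d -> R) :=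
  [/\ Rd_measurable_fun Omega (fun x => a x (w x) (grad w x)),
      forall i, Rd_measurable_fun Omega (fun x => b x (w x) (grad w x) ord0 i) &
      Rd_measurable_fun Omega (fun x => c x (w x))].

End geometry.

(* Main.v *)
Require Import Defs.
From mathcomp Require Import all_boot all_order all_algebra.
From mathcomp Require Import all_classical all_reals all_analysis.
From mathcomp Require Import measurable_realfun ring lra.

(** The proof is by contradiction, with a test function that lives on a single
layer of the mesh.  Suppose that the largest nodal value [m] of [uh] exceeds
[kstar], and let [k] be the largest number among [kstar] and the nodal values
below [m].  Then [v = (uh - k)_+] takes only the values 0 and [m - k] at the
nodes, so on every element it is either constant or vanishes at a vertex
([two_valued_affine]).  In the second case [0 <= v <= h |grad v|] there.

Boundary values of [uh] are at most [kstar <= k], so [v] is an admissible test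
function ([nodal_pos_P1space0]).  With [w = (uh - k)_-] we have
[uh = v + w + k], and subtracting the assumption on [Q(uh; w, v)] from the weak
formulation gives
[int (a |grad v|^2 + (b . grad v) v + c (v + k) v) <= F(v) <= 0].
The reaction term is nonnegative.  Since [|b| <= lambda nu], the first two terms
are at least [lambda (1 - h nu) |grad v|^2] ([energy_lower_bound]), which is
where [h nu < 1] enters.  A nonnegative function whose integral is nonpositive
vanishes almost everywhere ([Rintegral_le0_ae_eq0]), so [grad v] is zero on every
element and [v] takes only the values 0 and [m - k] on the connected set
[closure Omega].  It vanishes on the boundary, which is not empty
([boundary_nonempty]), hence everywhere, although it equals [m - k] at a node
where [uh] attains its maximum.

Two groups of facts support this.  First, integrals over [Omega] have to be
computed element by element: hyperplanes are negligible
([hyperplane_negligible]), so almost every point of [Omega] lies in the interior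
of an element ([domain_elem_negligible]), where gradients are constant
([grad_affine]); open sets are not negligible ([open_not_negligible]).  Second,
[nodal_pos] is defined by choice, and its characteristic property
([nodal_posP]) requires the existence of continuous piecewise affine functions
with prescribed nodal values; they exist because two elements meet in a common
face, and simplices sharing a face share its vertices ([eq_face_vertex]). *)

Import Order.TTheory GRing.Theory Num.Theory.
Import numFieldNormedType.Exports.

Local Open Scope classical_set_scope.
Local Open Scope ring_scope.

Set Implicit Arguments.
Unset Strict Implicit.
Unset Printing Implicit Defensive.

(** * Hyperplanes and cubes under the iterated product measure *)

Section tuple_measure.
Context {R : realType}.
Implicit Types (n : nat) (r e : R).

Lemma measurable_tuple_linear n (q : 'I_n -> R) :
  measurable_fun [set: n.-tuple (measurableTypeR R)]
    (fun t => \sum_i q i * tnth t i).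
Proof.
apply: measurable_sum => i; apply: measurable_funM => //.
exact: measurable_tnth.
Qed.

Lemma measurable_tuple_hyperplane n (q : 'I_n -> R) r :
  measurable [set t : n.-tuple (measurableTypeR R) | \sum_i q i * tnth t i = r].
Proof.
rewrite -[X in measurable X]setTI.
exact: (measurable_tuple_linear q measurableT (measurable_set1 r)).
Qed.

(** Fubini along the first coordinate: if some later coefficient is nonzero, all
sections are hyperplanes of one dimension less; otherwise all sections but one
are empty. *)
Lemma tuple_lebesgue_hyperplane n (q : 'I_n -> R) r : (exists i, q i != 0) ->
  tuple_lebesgue R n [set t | \sum_i q i * tnth t i = r] = 0%E.
Proof.
elim: n => [|n IH] in q r *; first by case=> -[].
move=> qn0; pose H := [set t : n.+1.-tuple (measurableTypeR R) |
  \sum_i q i * tnth t i = r].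
have mH : measurable (@tuple_cons R n @^-1` H).
  rewrite -[X in measurable X]setTI; apply: measurable_tuple_cons => //.
  exact: measurable_tuple_hyperplane.
rewrite -[LHS]/(\int[@lebesgue_measure R]_x
  (tuple_lebesgue R n \o xsection (@tuple_cons R n @^-1` H)) x)%E.
have secE x : xsection (@tuple_cons R n @^-1` H) x =
    [set t | \sum_i q (lift ord0 i) * tnth t i = r - q ord0 * x].
  apply/seteqP; split => t; rewrite /xsection /= inE /H /= big_ord_recl /=.
    by under eq_bigr do rewrite tnthS; move=> <-; rewrite tnth0 addrC addKr.
  by move=> E; under eq_bigr do rewrite tnthS; rewrite E tnth0 addrC subrK.
have [[i qi]|q0] := pselect (exists i, q (lift ord0 i) != 0).
  apply: integral0_eq => x _ /=; rewrite secE; apply: IH; by exists i.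
have q00 : q ord0 != 0.
  case: qn0 => i; case: (unliftP ord0 i) => [j ->|-> //] qj.
  by case: q0; exists j.
have q0E i : q (lift ord0 i) = 0.
  by apply/eqP/negPn/negP => h; apply: q0; exists i.
rewrite (@ae_eq_integral _ _ _ (@lebesgue_measure R) _ (cst 0%E)) //.
- exact: integral0.
- exact: measurable_fun_xsection.
exists [set r / q ord0]; split; [exact: measurable_set1|exact: lebesgue_measure_set1|].
move=> x /=; apply: contra_notP => xr _; rewrite secE.
rewrite (_ : [set _ | _] = set0) ?measure0 //; apply/seteqP; split => // t /=.
rewrite big1 => [/esym/eqP|i _]; last by rewrite q0E mul0r.
by rewrite subr_eq0 => /eqP rE; apply: xr; rewrite rE mulrC mulKf.
Qed.

Definition tuple_cube n (x : 'I_n -> R) e :=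
  [set t : n.-tuple (measurableTypeR R) | forall i, tnth t i \in `]x i - e, x i + e[].

Lemma measurable_tuple_cube n (x : 'I_n -> R) e : measurable (tuple_cube x e).
Proof.
rewrite [X in measurable X](_ : _ =
  \bigcap_(i in [set: 'I_n]) ((@tnth n _ ^~ i) @^-1` `]x i - e, x i + e[)).
  apply: fin_bigcap_measurable => // i _.
  by rewrite -[X in measurable X]setTI; apply: measurable_tnth.
by apply/seteqP; split => t h i //=; apply: h.
Qed.

Lemma tuple_lebesgue_cube n (x : 'I_n -> R) e : 0 < e ->
  tuple_lebesgue R n (tuple_cube x e) = ((e *+ 2) ^+ n)%:E.
Proof.
move=> e0; elim: n => [|n IH] in x *.
  by rewrite /= diracE mem_set // => -[].
rewrite -[LHS]/((@lebesgue_measure R \x tuple_lebesgue R n)%E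
  (@tuple_cons R n @^-1` (tuple_cube x e))).
rewrite (_ : _ @^-1` _ = `]x ord0 - e, x ord0 + e[ `*`
   tuple_cube (fun i => x (lift ord0 i)) e); last first.
  apply/seteqP; split => -[y t] /=.
    move=> h; split; first exact: (h ord0).
    by move=> i; have := h (lift ord0 i); rewrite tnthS.
  move=> [h1 h2] i; case: (unliftP ord0 i) => [j ->|-> //].
  by rewrite tnthS; exact: h2.
rewrite product_measure1E //; last exact: measurable_tuple_cube.
rewrite IH exprS EFinM; congr (_ * _)%E; apply: etrans (lebesgue_measure_itv _) _.
by rewrite /= lte_fin ifT -?EFinB; [congr EFin; rewrite mulr2n; ring | lra].
Qed.

End tuple_measure.

(** * Lebesgue measure on row vectors *)

Lemma bigcup_finE (T : Type) (I : finType) (F : I -> set T) :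
  \bigcup_(i : I) F i = \big[setU/set0]_(i <- enum I) F i.
Proof.
rewrite -bigcup_seq; apply/seteqP; split => x [i _ Fi]; exists i => //.
by rewrite /= mem_enum.
Qed.

Lemma negligible_bigcup_fin d (T : measurableType d) (R : realType)
    (mu : {measure set T -> \bar R}) (I : finType) (F : I -> set T) :
  (forall i, mu.-negligible (F i)) -> mu.-negligible (\bigcup_(i : I) F i).
Proof.
move=> F0; rewrite bigcup_finE.
by elim/big_ind : _ => [|A B|i _]; [exact: negligible_set0|exact: negligibleU|exact: F0].
Qed.

Section Rd_measure.
Context {R : realType} {d : nat}.
Implicit Types (q x : 'rV[R]_d) (X : set 'rV[R]_d) (r e : R).
Local Notation mu := (@lebesgue_Rd R d).

(** Measurable sets of tuples are Caratheodory measurable for the outer measure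
that they induce. *)
Lemma Rd_measurable_preimage X :
  measurable (@row_of_tuple R d @^-1` X) -> measurable (X : set (Rd_leb R d)).
Proof.
move=> mX; rewrite /measurable /=; suff: caratheodory_measurable (@lebesgue_outer R d) X by [].
move=> Y.
rewrite /lebesgue_outer !preimage_setI preimage_setC.
exact: (caratheodory_measurable_mu_ext (tuple_lebesgue R d) mX).
Qed.

Lemma lebesgue_RdE X : measurable (@row_of_tuple R d @^-1` X) ->
  mu X = tuple_lebesgue R d (@row_of_tuple R d @^-1` X).
Proof. exact: measurable_mu_extE. Qed.

Lemma lebesgue_Rd_complete : measure_is_complete mu.
Proof. exact: (@measure_is_complete_caratheodory _ _ (@lebesgue_outer R d)). Qed.

Lemma vdot_row_of_tuple q t : vdot q (row_of_tuple t) = \sum_i q ord0 i * tnth t i.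
Proof. by apply: eq_bigr => i _; rewrite mxE. Qed.

Lemma measurable_vdot q (D : set (Rd_leb R d)) :
  measurable_fun D (vdot q : Rd_leb R d -> measurableTypeR R).
Proof.
apply: measurable_funTS => _ B mB; rewrite setTI.
apply: Rd_measurable_preimage; rewrite -[X in measurable X]setTI.
rewrite -comp_preimage (_ : _ \o _ = fun t => \sum_i q ord0 i * tnth t i).
  exact: measurable_tuple_linear.
by apply/funext => t; exact: vdot_row_of_tuple.
Qed.

Lemma measurable_affine q r (D : set (Rd_leb R d)) :
  measurable_fun D ((fun x => vdot q x + r) : Rd_leb R d -> measurableTypeR R).
Proof. by apply: measurable_funD => //; exact: measurable_vdot. Qed.

Lemma hyperplane_negligible q r : q != 0 -> mu.-negligible [set x | vdot q x = r].
Proof.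
move=> q0; have mH : measurable (@row_of_tuple R d @^-1` [set x | vdot q x = r]).
  rewrite (_ : _ @^-1` _ = [set t | \sum_i q ord0 i * tnth t i = r]).
    exact: measurable_tuple_hyperplane.
  by apply/seteqP; split => t /=; rewrite vdot_row_of_tuple.
exists [set x | vdot q x = r]; split => //.
  exact: Rd_measurable_preimage.
apply: etrans (lebesgue_RdE mH) _; rewrite (_ : _ @^-1` _ =
    [set t | \sum_i q ord0 i * tnth t i = r]).
  apply: tuple_lebesgue_hyperplane; apply: contrapT => h.
  move/eqP: q0; apply; apply/rowP => i; rewrite mxE.
  by apply/eqP/negPn/negP => hi; apply: h; exists i.
by apply/seteqP; split => t /=; rewrite vdot_row_of_tuple.
Qed.

Definition cube x e := [set y : 'rV[R]_d | forall i, y ord0 i \in `]x ord0 i - e, x ord0 i + e[].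

Let cube_preimage x e :
  @row_of_tuple R d @^-1` cube x e = tuple_cube (fun i => x ord0 i) e.
Proof. by apply/seteqP; split => t /= h i; move: (h i); rewrite mxE. Qed.

Lemma measurable_cube x e : measurable (cube x e : set (Rd_leb R d)).
Proof.
apply: Rd_measurable_preimage; rewrite cube_preimage.
exact: measurable_tuple_cube.
Qed.

Lemma lebesgue_cube x e : 0 < e -> mu (cube x e) = ((e *+ 2) ^+ d)%:E.
Proof.
move=> e0; rewrite lebesgue_RdE cube_preimage ?tuple_lebesgue_cube //.
exact: measurable_tuple_cube.
Qed.

Lemma open_cube_sub X x : open X -> X x -> exists2 e, 0 < e & cube x e `<=` X.
Proof.
rewrite openE => oX /oX /nbhs_ballP [e /= e0 eX]; exists e => // y xy.
apply: eX; split => // i j; rewrite (ord1 i) /ball /=.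
by have := xy j; rewrite in_itv /= => /andP[h1 h2]; rewrite ltr_norml; lra.
Qed.

(** An open set contains a cube, and cubes have explicit positive measure. *)
Lemma open_not_negligible X : open X -> X !=set0 -> ~ mu.-negligible X.
Proof.
move=> oX [x Xx] [N [mN N0 XN]]; have [e e0 eX] := open_cube_sub oX Xx.
have : (mu (cube x e) <= mu N)%E.
  by apply: le_measure; rewrite ?inE //; [exact: measurable_cube|exact: subset_trans XN].
by rewrite [mu N]N0 lebesgue_cube // lee_fin leNgt exprn_gt0 // pmulrn_lgt0.
Qed.

Lemma coord_le_norm x i : `|x ord0 i| <= `|x|.
Proof.
by rewrite [leRHS]/Num.norm /= mx_normrE; apply/bigmax_geP; right => /=; exists (ord0, i).
Qed.

Lemma bounded_lebesgue_lty X : measurable (X : set (Rd_leb R d)) ->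
  bounded_set X -> (mu X < +oo)%E.
Proof.
move=> mX [C [_ bX]]; pose e := `|C| + 1 + 1.
have e0 : 0 < e by rewrite /e; have := normr_ge0 C; lra.
have Xe : X `<=` cube 0 e.
  move=> x /(bX (`|C| + 1)) xC i; rewrite mxE in_itv /=.
  have /xC xle : C < `|C| + 1 by have := ler_norm C; lra.
  have : `|x ord0 i| <= `|C| + 1.
    by apply: le_trans xle; exact: coord_le_norm.
  by rewrite ler_norml /e => /andP[h1 h2]; apply/andP; split; lra.
apply: (@le_lt_trans _ _ (mu (cube 0 e))).
  by apply: le_measure; rewrite ?inE //; exact: measurable_cube.
by rewrite lebesgue_cube // ltry.
Qed.

End Rd_measure.

(** * The Euclidean inner product *)

Section vdot_theory.
Context {R : realType} {d : nat}.
Implicit Types (u v w : 'rV[R]_d).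

Lemma vdotDl u v w : vdot (u + v) w = vdot u w + vdot v w.
Proof. by rewrite /vdot -big_split; apply: eq_bigr => i _; rewrite mxE mulrDl. Qed.

Lemma vdotZl (k : R) u w : vdot (k *: u) w = k * vdot u w.
Proof. by rewrite /vdot mulr_sumr; apply: eq_bigr => i _; rewrite mxE mulrA. Qed.

Lemma vdotC u v : vdot u v = vdot v u.
Proof. by apply: eq_bigr => i _; rewrite mulrC. Qed.

Lemma vdotBl u v w : vdot (u - v) w = vdot u w - vdot v w.
Proof. by rewrite -scaleN1r vdotDl vdotZl mulN1r. Qed.

Lemma vdot0l w : vdot 0 w = 0.
Proof. by rewrite -(scale0r 0) vdotZl mul0r. Qed.

Lemma vdotDr u v w : vdot u (v + w) = vdot u v + vdot u w.
Proof. by rewrite ![vdot u _]vdotC vdotDl. Qed.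

Lemma vdotBr u v w : vdot u (v - w) = vdot u v - vdot u w.
Proof. by rewrite ![vdot u _]vdotC vdotBl. Qed.

Lemma vdotZr (k : R) u v : vdot u (k *: v) = k * vdot u v.
Proof. by rewrite ![vdot u _]vdotC vdotZl. Qed.

Lemma vdot_sumr I (s : seq I) (P : pred I) u (F : I -> 'rV[R]_d) :
  vdot u (\sum_(i <- s | P i) F i) = \sum_(i <- s | P i) vdot u (F i).
Proof.
elim/big_rec2 : _ => [|i y z _ <-]; last by rewrite vdotDr.
by rewrite vdotC vdot0l.
Qed.

Lemma vdot_ge0 u : 0 <= vdot u u.
Proof. by apply: sumr_ge0 => i _; rewrite -expr2 sqr_ge0. Qed.

Lemma vdot_eq0 u : vdot u u = 0 -> u = 0.
Proof.
move=> /eqP; rewrite psumr_eq0 => [/allP h|i _]; last by rewrite -expr2 sqr_ge0.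
apply/rowP => i; rewrite mxE; apply/eqP.
by have := h i (mem_index_enum i); rewrite mulf_eq0 orbb.
Qed.

Lemma enorm_ge0 u : 0 <= enorm u.
Proof. exact: sqrtr_ge0. Qed.

Lemma sqr_enorm u : enorm u ^+ 2 = vdot u u.
Proof. by rewrite sqr_sqrtr ?vdot_ge0. Qed.

(** Cauchy-Schwarz: with [a = |u|^2] and [b = u . v], the square of the length of
[a v - b u] is [a (|u|^2 |v|^2 - b^2)]. *)
Lemma vdot_le_enorm u v : `|vdot u v| <= enorm u * enorm v.
Proof.
rewrite -(@ler_pXn2r _ 2) ?nnegrE ?mulr_ge0 ?enorm_ge0 //.
rewrite exprMn !sqr_enorm real_normK ?num_real //.
have [u0|u0] := eqVneq (vdot u u) 0.
  by rewrite (vdot_eq0 u0) !vdot0l expr0n mul0r.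
have := vdot_ge0 (vdot u u *: v - vdot u v *: u).
rewrite vdotBl !vdotBr !vdotZl !vdotZr (vdotC v u).
set a := vdot u u; set b := vdot u v; set c := vdot v v.
rewrite (_ : _ - _ = a * (a * c - b ^+ 2)); last by ring.
by rewrite pmulr_rge0 ?subr_ge0 // lt_def u0 vdot_ge0.
Qed.

Lemma vdot_continuous u : continuous (vdot u).
Proof.
apply: continuous_big => [|i _ x]; first exact: add_continuous.
by apply: cvgMr; [exact: nbhs_filter|exact: (@coord_continuous R _ _ ord0 i x)].
Qed.

Lemma affine_continuous u (r : R) : continuous (fun x => vdot u x + r).
Proof.
move=> x; apply: cvgD; [exact: nbhs_filter|exact: (@vdot_continuous u x)|].
by apply: cvg_cst; exact: nbhs_filter.
Qed.

End vdot_theory.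

(** * Barycentric coordinates *)

Section barycentric.
Context {R : realType} {d : nat}.
Implicit Types (p : 'I_d.+1 -> 'rV[R]_d) (x : 'rV[R]_d) (I : {set 'I_d.+1}).

(** A leading coordinate 1 turns affine combinations of points into linear
combinations of rows.  Barycentric coordinates then solve a square linear system
and are affine functions on the whole space, which makes faces sets of affine
inequalities. *)
Definition homogeneous x : 'rV[R]_d.+1 :=
  \row_j if unlift ord0 j is Some j' then x ord0 j' else 1.

Definition vertex_mx p : 'M[R]_d.+1 := \matrix_i homogeneous (p i).

Definition bary p x (i : 'I_d.+1) : R :=
  (homogeneous x *m invmx (vertex_mx p)) ord0 i.

Definition bary_grad p i : 'rV[R]_d :=
  \row_j invmx (vertex_mx p) (lift ord0 j) i.

Lemma bary_affine p x i :
  bary p x i = vdot (bary_grad p i) x + invmx (vertex_mx p) ord0 i.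
Proof.
rewrite /bary mxE big_ord_recl !mxE unlift_none mul1r addrC; congr (_ + _).
by apply: eq_bigr => j _; rewrite !mxE liftK mulrC.
Qed.

Section affinely_independent.
Variables (p : 'I_d.+1 -> 'rV[R]_d) (hp : affinely_independent p).

Lemma mul_vertex_mx (l : 'rV[R]_d.+1) : l *m vertex_mx p =
  \row_j if unlift ord0 j is Some j' then (\sum_i l ord0 i *: p i) ord0 j'
         else \sum_i l ord0 i.
Proof.
apply/rowP => j; rewrite !mxE; case: (unliftP ord0 j) => [j' ->|->].
  by rewrite summxE; apply: eq_bigr => i _; rewrite !mxE liftK.
by apply: eq_bigr => i _; rewrite !mxE unlift_none mulr1.
Qed.

Lemma vertex_mx_unit : vertex_mx p \in unitmx.
Proof.
rewrite -row_free_unit; apply: inj_row_free => l; rewrite mul_vertex_mx => /rowP h.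
apply/rowP => i; rewrite [RHS]mxE; apply: (hp (l := fun i => l ord0 i)).
  by have := h ord0; rewrite !mxE unlift_none.
by apply/rowP => j; have := h (lift ord0 j); rewrite !mxE liftK.
Qed.

Lemma bary_mul x : (\row_i bary p x i) *m vertex_mx p = homogeneous x.
Proof.
rewrite (_ : \row_i _ = homogeneous x *m invmx (vertex_mx p)).
  by rewrite mulmxKV // vertex_mx_unit.
by apply/rowP => i; rewrite [LHS]mxE.
Qed.

Lemma sum_bary x : \sum_i bary p x i = 1.
Proof.
have /rowP/(_ ord0) := bary_mul x; rewrite mul_vertex_mx !mxE unlift_none.
by under eq_bigr do rewrite mxE.
Qed.

Lemma baryK x : \sum_i bary p x i *: p i = x.
Proof.
apply/rowP => j; have /rowP/(_ (lift ord0 j)) := bary_mul x.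
rewrite mul_vertex_mx [LHS]mxE [RHS]mxE liftK.
by under eq_bigr do rewrite mxE.
Qed.

Lemma bary_unique x (l : 'I_d.+1 -> R) : \sum_i l i = 1 -> x = \sum_i l i *: p i ->
  bary p x =1 l.
Proof.
move=> l1 xl i; apply/eqP; rewrite -subr_eq0; apply/eqP.
apply: (hp (l := fun i => bary p x i - l i)).
  by rewrite sumrB sum_bary l1 subrr.
by under eq_bigr do rewrite scalerBl; rewrite sumrB baryK -xl subrr.
Qed.

Lemma bary_vertex i j : bary p (p i) j = (j == i)%:R.
Proof.
apply: (bary_unique (l := fun j => (j == i)%:R)).
  by rewrite (bigD1 i) //= eqxx big1 ?addr0 // => k /negPf ->.
by rewrite (bigD1 i) //= eqxx scale1r big1 ?addr0 // => k /negPf ->; rewrite scale0r.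
Qed.

Lemma faceE I : face p I =
  [set x | forall i, 0 <= bary p x i /\ (i \notin I -> bary p x i = 0)].
Proof.
apply/seteqP; split => x /=.
  move=> [l [l0 lI l1 xl]] i; rewrite (bary_unique l1 xl); split => //; exact: lI.
move=> h; exists (bary p x); split; first by move=> i; case: (h i).
- by move=> i; case: (h i).
- exact: sum_bary.
- by rewrite baryK.
Qed.

Lemma simplexE : simplex p = [set x | forall i, 0 <= bary p x i].
Proof.
by rewrite /simplex faceE; apply/seteqP; split => x /= h i; [case: (h i)|rewrite inE].
Qed.

Lemma sub_face_simplex I : face p I `<=` simplex p.
Proof. by rewrite faceE simplexE => x h i; case: (h i). Qed.

Lemma vertex_face I i : i \in I -> face p I (p i).
Proof.
move=> iI; rewrite faceE => j; rewrite bary_vertex; split; first exact: ler0n.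
by have [->|//] := eqVneq j i; rewrite iI.
Qed.

Lemma vertex_simplex i : simplex p (p i).
Proof. by apply: vertex_face; rewrite inE. Qed.

Lemma affine_on_bary v x : affine_on (simplex p) v -> simplex p x ->
  v x = \sum_i bary p x i * v (p i).
Proof.
move=> [q [r vE]] px; rewrite vE // -[in LHS](baryK x) vdot_sumr.
rewrite -[r in LHS]mul1r -(sum_bary x) mulr_suml -big_split.
by apply: eq_bigr => i _; rewrite /= vdotZr -mulrDr -vE //; exact: vertex_simplex.
Qed.

Lemma bary_le1 x i : simplex p x -> bary p x i <= 1.
Proof.
rewrite simplexE => px; rewrite -(sum_bary x) (bigD1 i) //= lerDl.
by apply: sumr_ge0 => j _; exact: px.
Qed.

Lemma bounded_simplex : exists C, forall x, simplex p x -> `|x| <= C.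
Proof.
exists (\sum_i `|p i|) => x px; rewrite -(baryK x).
apply: le_trans (ler_norm_sum _ _ _) _; apply: ler_sum => i _.
rewrite normrZ ler_piMl // ger0_norm ?bary_le1 //.
by move: px; rewrite simplexE; exact.
Qed.

Lemma enorm_le_ediam x y : simplex p x -> simplex p y ->
  enorm (x - y) <= ediam (simplex p).
Proof.
move=> px py; apply: ub_le_sup; last by exists x, y.
have [C hC] := bounded_simplex; exists (Num.sqrt (\sum_(i < d) (C + C) ^+ 2)).
move=> _ [u [v [pu pv ->]]]; apply: ler_wsqrtr; apply: ler_sum => i _.
rewrite -expr2 -real_normK ?num_real // ler_sqr ?nnegrE ?(coord_le_norm, normr_ge0) //.
  apply: le_trans (coord_le_norm _ _) _; apply: le_trans (ler_normB _ _) _.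
  by rewrite lerD // hC.
by have := hC _ pu; have := normr_ge0 u; lra.
Qed.

Lemma bary_continuous i : continuous (bary p ^~ i).
Proof.
rewrite (_ : bary p ^~ i = fun x => vdot (bary_grad p i) x + invmx (vertex_mx p) ord0 i).
  exact: affine_continuous.
by apply/funext => x; exact: bary_affine.
Qed.

Lemma closed_simplex : closed (simplex p).
Proof.
rewrite simplexE (_ : [set _ | _] = \bigcap_(i in setT) (bary p ^~ i @^-1` [set r | 0 <= r])).
  apply: closed_bigI => i _; apply: preimage_closed; last exact: closed_ge.
  by move=> x _; exact: bary_continuous.
by apply/seteqP; split => x /= h i; [move=> _; exact: h|exact: (h i I)].
Qed.

Definition open_simplex := [set x | forall i, 0 < bary p x i].

Lemma open_simplex_open : open open_simplex.
Proof.
rewrite (_ : open_simplex =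
    \big[setI/setT]_(i <- enum 'I_d.+1) (bary p ^~ i @^-1` [set r | 0 < r])).
  elim/big_ind : _ => [|A B|i _]; [exact: openT|exact: openI|].
  apply: open_comp; last exact: open_gt.
  by move=> x _; exact: bary_continuous.
rewrite -bigcap_seq; apply/seteqP; split => x h i; first by move=> _; exact: h.
by apply: (h i); rewrite /= mem_enum.
Qed.

Lemma sub_open_simplex : open_simplex `<=` simplex p.
Proof. by rewrite simplexE => x h i; exact/ltW/h. Qed.

Lemma open_simplex_nonempty : open_simplex !=set0.
Proof.
exists (\sum_i d.+1%:R^-1 *: p i) => i.
rewrite (bary_unique (l := fun=> d.+1%:R^-1)) //=.
by rewrite sumr_const card_ord -[LHS]mulr_natr mulVf // pnatr_eq0.
Qed.

Lemma measurable_bary i (D : set (Rd_leb R d)) :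
  measurable_fun D (bary p ^~ i : Rd_leb R d -> measurableTypeR R).
Proof.
rewrite (_ : bary p ^~ i = fun x => vdot (bary_grad p i) x + invmx (vertex_mx p) ord0 i).
  exact: measurable_affine.
by apply/funext => x; exact: bary_affine.
Qed.

Lemma measurable_face I : measurable (face p I : set (Rd_leb R d)).
Proof.
rewrite faceE (_ : [set _ | _] = \bigcap_(i in [set: 'I_d.+1])
    (bary p ^~ i @^-1` (if i \in I then `[0, +oo[%classic else [set 0]))).
  apply: fin_bigcap_measurable => // i _; rewrite -[X in measurable X]setTI.
  by apply: measurable_bary => //; case: ifP.
apply/seteqP; split => x /= h i; have := h i.
  by move=> [h1 h2] _ /=; case: ifPn => /= [_|/h2 //]; rewrite in_itv /= h1.
move=> /(_ Logic.I) /=; case: ifPn => [iI|_] /=; last by move=> ->.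
by rewrite in_itv /= andbT => ->.
Qed.

Lemma measurable_open_simplex : measurable (open_simplex : set (Rd_leb R d)).
Proof.
rewrite (_ : open_simplex = \bigcap_(i in [set: 'I_d.+1]) (bary p ^~ i @^-1` `]0, +oo[)).
  apply: fin_bigcap_measurable => // i _; rewrite -[X in measurable X]setTI.
  by apply: measurable_bary.
apply/seteqP; split => x /= h i; have := h i; rewrite /= in_itv /= andbT //.
exact.
Qed.

(** The coordinate is 1 at its own vertex and 0 at another one, which exists in
positive dimension. *)
Lemma bary_grad_neq0 i : (0 < d)%N -> bary_grad p i != 0.
Proof.
move=> d0; have [j ji] : exists j, j != i.
  have [->|i0] := eqVneq i ord0; last by exists ord0; rewrite eq_sym.
  by exists (lift ord0 (Ordinal d0)); rewrite eq_sym neq_lift.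
apply/eqP => q0; have := bary_vertex i i; have := bary_vertex j i.
rewrite !bary_affine q0 !vdot0l eq_sym (negPf ji) eqxx => -> /eqP.
by rewrite eq_sym oner_eq0.
Qed.

(** Points of the simplex that are not interior lie on one of the [d + 1]
hyperplanes where a barycentric coordinate vanishes. *)
Lemma simplexD_negligible : (0 < d)%N ->
  (@lebesgue_Rd R d).-negligible (simplex p `\` open_simplex).
Proof.
move=> d0; apply: (@negligibleS _ _ _ (@lebesgue_Rd R d) (\bigcup_(i : 'I_d.+1)
    [set x | vdot (bary_grad p i) x = - invmx (vertex_mx p) ord0 i])).
  move=> x; rewrite simplexE => -[h /existsNP[i hi]]; exists i => //.
  have : bary p x i = 0 by apply/eqP; rewrite eq_le h leNgt andbT; apply/negP.
  by rewrite bary_affine => /eqP; rewrite addr_eq0 => /eqP.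
apply: negligible_bigcup_fin => i; apply: hyperplane_negligible.
exact: bary_grad_neq0.
Qed.

End affinely_independent.
End barycentric.

(** * Gradients of locally affine functions *)

Section gradient.
Context {R : realType} {d : nat}.
Implicit Types (A : set 'rV[R]_d) (x q : 'rV[R]_d).

(** Near a point of the open set the difference quotients are constant. *)
Lemma grad_affine A (v : 'rV[R]_d -> R) q r x :
  (forall y, A y -> v y = vdot q y + r) -> open A -> A x -> grad v x = q.
Proof.
move=> vE oA Ax; apply/rowP => i; rewrite mxE.
have [e e0 eA] := open_cube_sub oA Ax.
apply: cvg_lim => //; apply: cvg_near_cst.
near=> h; have h0 : h != 0 by near: h; exact: nbhs_dnbhs_neq.
have he : `|h| < e by near: h; exact: dnbhs0_lt.
rewrite /= !vE //; last first.
  apply: eA => j; rewrite !mxE /= in_itv /=; move: he; rewrite ltr_norml.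
  by case: eqP => _ /andP[h1 h2]; rewrite ?mulr1 ?mulr0; apply/andP; split; lra.
rewrite vdotDr vdotZr addrAC opprD !addrA addrK addrAC addrK.
rewrite (_ : vdot q _ = q ord0 i); first by rewrite /GRing.scale /= mulKf.
rewrite /vdot (bigD1 i) //= mxE !eqxx mulr1 big1 ?addr0 // => j /negPf ji.
by rewrite mxE ji andbF mulr0.
Unshelve. all: by end_near. Qed.

End gradient.

(** * Nodal interpolation *)

Section nodal_interpolation.
Context {R : realType} {d : nat}.
Implicit Types (p : 'I_d.+1 -> 'rV[R]_d) (x : 'rV[R]_d).

Lemma bary_affine_fun p (hp : affinely_independent p) (q : 'rV[R]_d) r x :
  vdot q x + r = \sum_i bary p x i * (vdot q (p i) + r).
Proof.
under eq_bigr do rewrite mulrDr -vdotZr.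
by rewrite big_split /= -vdot_sumr baryK // -mulr_suml sum_bary // mul1r.
Qed.

(** Vertices are the extreme points of a face, so a common face of two simplices
has the same vertices in both.  This is how conformity of the mesh makes nodal
values determine a continuous function. *)
Lemma eq_face_vertex p p' (I J : {set 'I_d.+1}) :
  affinely_independent p -> affinely_independent p' ->
  face p I = face p' J -> forall i, i \in I -> exists j, p i = p' j.
Proof.
move=> hp hp' IJ i iI; pose m := bary p' (p i).
have : face p' J (p i) by rewrite -IJ; exact: vertex_face.
rewrite faceE // => /= hm.
have [j mj] : exists j, m j != 0.
  apply: contrapT => h; have : \sum_j m j = 0.
    by apply: big1 => j _; apply/eqP/negPn/negP => mj; apply: h; exists j.
  by rewrite sum_bary // => /eqP; rewrite oner_eq0.
have jJ : j \in J by apply: contraNT mj => /(proj2 (hm j)) /eqP.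
(* The coordinates in [p] of the vertex [p i] are averages, with the weights [m],
   of those of the vertices [p' l].  All terms are nonnegative, so a coordinate that
   vanishes at [p i] vanishes at every [p' l] with positive weight. *)
have combE k : bary p (p i) k = \sum_l m l * bary p (p' l) k.
  rewrite bary_affine (bary_affine_fun hp'); apply: eq_bigr => l _.
  by rewrite -bary_affine.
have m0 k l : 0 <= m l * bary p (p' l) k.
  have [lJ|lJ] := boolP (l \in J); last by rewrite /m (proj2 (hm l) lJ) mul0r.
  apply: mulr_ge0; first by case: (hm l).
  have : face p I (p' l) by rewrite IJ; exact: vertex_face.
  by rewrite faceE // => /(_ k)[].
have b0 k : k != i -> bary p (p' j) k = 0.
  move=> ki; have := combE k; rewrite bary_vertex // (negPf ki) => /esym/eqP.
  rewrite psumr_eq0 => [/allP/(_ j (mem_index_enum j))|l _]; last exact: m0.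
  by rewrite /= mulf_eq0 (negPf mj) => /eqP.
exists j; rewrite -[RHS](baryK hp) (bigD1 i) //= big1 => [|k /b0 ->]; last by rewrite scale0r.
have := sum_bary hp (p' j); rewrite (bigD1 i) //= big1 => [|k /b0 //].
by rewrite !addr0 => ->; rewrite scale1r.
Qed.

Definition lagrange p (f : 'rV[R]_d -> R) x := \sum_i bary p x i * f (p i).

Lemma lagrange_affine p f : exists q r, forall x, lagrange p f x = vdot q x + r.
Proof.
exists (\sum_i f (p i) *: bary_grad p i),
  (\sum_i f (p i) * invmx (vertex_mx p) ord0 i) => x.
rewrite vdotC vdot_sumr -big_split; apply: eq_bigr => i _ /=.
by rewrite bary_affine vdotZr [vdot x _]vdotC mulrC mulrDr.
Qed.

Lemma lagrange_vertex p f i : affinely_independent p -> lagrange p f (p i) = f (p i).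
Proof.
move=> hp; rewrite /lagrange (bigD1 i) //= bary_vertex // eqxx mul1r big1 ?addr0 //.
by move=> j /negPf ji; rewrite bary_vertex // ji mul0r.
Qed.

(** Both interpolants are affine, and they agree at the vertices of the common
face, of which [x] is a convex combination. *)
Lemma lagrange_face p p' (I J : {set 'I_d.+1}) f x :
  affinely_independent p -> affinely_independent p' ->
  face p I = face p' J -> face p I x -> lagrange p f x = lagrange p' f x.
Proof.
move=> hp hp' IJ; rewrite faceE // => hx.
have [q [r E]] := lagrange_affine p' f.
rewrite E (bary_affine_fun hp); apply: eq_bigr => i _; rewrite -E.
have [iI|/(proj2 (hx i)) ->] := boolP (i \in I); last by rewrite !mul0r.
by have [j ->] := eq_face_vertex hp hp' IJ iI; rewrite lagrange_vertex.
Qed.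

Variables (Omega : set 'rV[R]_d) (M : mesh R d) (hM : fe_partition Omega M).

Let hK (K : 'I_(nelt M)) : affinely_independent (vertex K) := @fe_nondegenerate _ _ _ _ hM K.

(** Any element containing [x] may be used: [lagrange_face] shows that the value
does not depend on the choice. *)
Definition nodal_interpolant (f : 'rV[R]_d -> R) x :=
  if [pick K : 'I_(nelt M) | `[< elem K x >]] is Some K
  then lagrange (vertex K) f x else 0.

Lemma nodal_interpolantE f (K : 'I_(nelt M)) x : elem K x ->
  nodal_interpolant f x = lagrange (vertex K) f x.
Proof.
rewrite /nodal_interpolant; case: pickP => [L /asboolP Lx Kx|/(_ K) /asboolP //].
have [->//|LK] := eqVneq L K; have [I [J [_ _ EI EJ]]] := fe_conforming hM LK.
by apply: (@lagrange_face _ _ I J) => //; rewrite -?EJ // -EI; split.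
Qed.

Lemma within_bigcup_continuous (I : finType) (T U : topologicalType)
    (A : I -> set T) (f : T -> U) :
  (forall i, closed (A i)) -> (forall i, {within A i, continuous f}) ->
  {within \bigcup_(i : I) A i, continuous f}.
Proof.
move=> cA fA; rewrite bigcup_finE.
suff [] : closed (\big[setU/set0]_(i <- enum I) A i) /\
  {within \big[setU/set0]_(i <- enum I) A i, continuous f} by [].
elim/big_ind : _ => [|B C [cB fB] [cC fC]|i _]; last by split.
  by split; [exact: closed0|exact: continuous_subspace0].
by split; [exact: closedU|exact: withinU_continuous].
Qed.

Lemma nodal_interpolant_P1space f : P1space Omega M (nodal_interpolant f).
Proof.
split=> [|K]; last first.
  have [q [r E]] := lagrange_affine (vertex K) f.
  by exists q, r => x Kx; rewrite (nodal_interpolantE _ Kx).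
rewrite (fe_cover hM); apply: within_bigcup_continuous => K.
  exact: (closed_simplex (@hK K)).
have [q [r E]] := lagrange_affine (vertex K) f.
apply: (@subspace_eq_continuous _ _ _ (fun x => vdot q x + r)).
  by move=> x /set_mem Kx; rewrite /from_subspace (nodal_interpolantE _ Kx) E.
by apply: continuous_subspaceT; exact: affine_continuous.
Qed.

(** The set from which [nodal_pos] is chosen contains the nodal interpolant. *)
Lemma nodal_posP v k : P1space Omega M (nodal_pos Omega M v k) /\
  forall z, nodes M z -> nodal_pos Omega M v k z = if k <= v z then v z - k else 0.
Proof.
apply: (@xgetPex _ (fun=> 0) [set w | P1space Omega M w /\
    forall z, nodes M z -> w z = if k <= v z then v z - k else 0]).
exists (nodal_interpolant (fun z => if k <= v z then v z - k else 0)).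
split; first exact: nodal_interpolant_P1space.
move=> z [K [i ->]]; rewrite (@nodal_interpolantE _ K) ?lagrange_vertex //.
exact: (vertex_simplex (@hK K)).
Qed.

End nodal_interpolation.

(** * Integration over a meshed domain *)

Section integration.
Context {R : realType} {d : nat}.
Local Notation mu := (@lebesgue_Rd R d).
Implicit Types (F : 'rV[R]_d -> R).

Lemma negligible_measurable_fun (N : set (Rd_leb R d)) F :
  mu.-negligible N -> measurable_fun N (F : Rd_leb R d -> measurableTypeR R).
Proof.
by move=> N0 _ B mB; apply: lebesgue_Rd_complete; apply: (@negligibleS _ _ _ mu N).
Qed.

(** A nonnegative integrand is its own absolute value, and the integral of an
absolute value detects the null functions. *)
Lemma Rintegral_le0_ae_eq0 (D : set (Rd_leb R d)) F : measurable D ->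
  Rd_integrable D F -> mu.-negligible (D `&` [set x | F x < 0]) ->
  \int[mu]_(x in D) F x <= 0 -> mu.-negligible (D `&` [set x | F x != 0]).
Proof.
move=> mD iF F0; rewrite -lee_fin fineK; last exact: integrable_fin_num.
have mF := measurable_int _ iF.
rewrite (_ : (\int[mu]_(x in D) (F x)%:E = \int[mu]_(x in D) `|(F x)%:E|)%E); last first.
  apply: ae_eq_integral => //; first exact: measurableT_comp.
  apply: (@negligibleS _ _ _ mu _ _ _ F0) => x /= /not_implyP[Dx /eqP H].
  by split => //; rewrite ltNge; apply: contraNN H => /ger0_norm Fx; rewrite /= Fx.
move=> i0; have : (\int[mu]_(x in D) `|(F x)%:E| = 0)%E.
  by apply/eqP; rewrite eq_le i0 integral_ge0.
move=> /(ae_eq_integral_abs _ mD mF); apply: negligibleS => x [Dx /eqP Fx] /=.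
by move=> /(_ Dx) [].
Qed.

(** Almost everywhere the integrand is the opposite of its absolute value. *)
Lemma Rintegral_le0_ae (D : set (Rd_leb R d)) F : measurable D ->
  Rd_integrable D F -> mu.-negligible (D `&` [set x | 0 < F x]) ->
  \int[mu]_(x in D) F x <= 0.
Proof.
move=> mD iF F0; rewrite -lee_fin fineK; last exact: integrable_fin_num.
have mF := measurable_int _ iF.
rewrite (_ : (\int[mu]_(x in D) (F x)%:E = \int[mu]_(x in D) - `|(F x)%:E|)%E); last first.
  apply: ae_eq_integral => //.
    by apply: measurableT_comp => //; exact: measurableT_comp.
  apply: (@negligibleS _ _ _ mu _ _ _ F0) => x /= /not_implyP[Dx /eqP H].
  split => //; rewrite ltNge; apply: contraNN H => /ler0_norm Fx.
  by rewrite /= Fx opprK.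
by rewrite integral_ge0N ?oppe_le0 ?integral_ge0.
Qed.

Variables (Omega : set 'rV[R]_d) (M : mesh R d) (d0 : (0 < d)%N).
Hypotheses (hO : bounded_domain Omega) (hM : fe_partition Omega M).

Let hK (K : 'I_(nelt M)) : affinely_independent (vertex K) :=
  @fe_nondegenerate _ _ _ _ hM K.

Lemma sub_closure_elem x : closure Omega x -> exists K : 'I_(nelt M), elem K x.
Proof. by rewrite (fe_cover hM) => -[K _ Kx]; exists K. Qed.

Lemma elem_sub_closure (K : 'I_(nelt M)) : elem K `<=` closure Omega.
Proof. by move=> x Kx; rewrite (fe_cover hM); exists K. Qed.

Lemma boundaryE : boundary Omega = closure Omega `\` Omega.
Proof.
by have [oO _ _ _] := hO; rewrite /boundary (iffLR (interior_id Omega) oO).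
Qed.

(** The closure is a finite union of elements and the boundary a finite union of
faces, by [fe_boundary]. *)
Lemma measurable_domain : measurable (Omega : set (Rd_leb R d)).
Proof.
have sO : Omega `<=` closure Omega by exact: subset_closure.
rewrite (_ : Omega = closure Omega `\` boundary Omega); last first.
  rewrite boundaryE; apply/seteqP; split => x /= h.
    by split; [exact: sO|case].
  by apply: contrapT => nOx; apply: h.2; split => //; exact: h.1.
apply: measurableD.
  by rewrite (fe_cover hM); apply: fin_bigcup_measurable => // K _; exact: measurable_face.
rewrite (_ : boundary Omega = \bigcup_(KI in [set KI : 'I_(nelt M) * {set 'I_d.+1} |
    face (vertex KI.1) KI.2 `<=` boundary Omega]) face (vertex KI.1) KI.2).
  by apply: fin_bigcup_measurable => // K _; exact: measurable_face.
apply/seteqP; split => x; last by case=> KI sKI; exact: sKI.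
by move=> /(fe_boundary hM)[K [I [h1 h2]]]; exists (K, I).
Qed.

Lemma domain_elem_negligible : mu.-negligible
  (Omega `\` \bigcup_(K : 'I_(nelt M)) open_simplex (vertex K)).
Proof.
apply: (@negligibleS _ _ _ mu (\bigcup_(K : 'I_(nelt M))
    (elem K `\` open_simplex (vertex K)))).
  move=> x [Ox nx]; have [K Kx] := sub_closure_elem (subset_closure Ox).
  by exists K => //; split => // Kx'; apply: nx; exists K.
by apply: negligible_bigcup_fin => K; apply: simplexD_negligible.
Qed.

(** The element interiors cover [Omega] up to a negligible set, on which every
function is measurable because the measure is complete.  So gradients need no
attention on the faces between elements. *)
Lemma elementwise_integrable F :
  (forall K : 'I_(nelt M), Rd_measurable_fun (Omega `&` open_simplex (vertex K)) F) ->
  (forall K : 'I_(nelt M), exists C, forall x,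
     Omega x -> open_simplex (vertex K) x -> `|F x| <= C) ->
  Rd_integrable Omega F.
Proof.
move=> mF bF; pose U := \bigcup_(K : 'I_(nelt M)) open_simplex (vertex K).
have mU : measurable (U : set (Rd_leb R d)).
  by apply: fin_bigcup_measurable => // K _; exact: measurable_open_simplex.
have mO := measurable_domain.
have mFO : measurable_fun (Omega : set (Rd_leb R d))
    (F : Rd_leb R d -> measurableTypeR R).
  rewrite -(setUIDK Omega U); apply/measurable_funU; [exact: measurableI|exact: measurableD|].
  split; last exact/negligible_measurable_fun/domain_elem_negligible.
  rewrite setI_bigcupr => mOU B mB; rewrite setI_bigcupl.
  apply: fin_bigcup_measurable => // K _; apply: mF => //.
  by apply: measurableI => //; exact: measurable_open_simplex.
have [C hC] := choice bF.
apply/integrableP; split; first exact/measurable_EFinP.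
apply: (@le_lt_trans _ _ ((\sum_K `|C K|)%:E * mu Omega)%E).
  apply: integral_le_bound => //; first exact/measurable_EFinP.
    by rewrite lee_fin sumr_ge0.
  apply: (@negligibleS _ _ _ mu _ _ _ domain_elem_negligible) => x /= /not_implyP[Ox H].
  split => // -[K _ Kx]; apply: H; rewrite lee_fin.
  apply: le_trans (hC K x Ox Kx) _; rewrite (bigD1 K) //=.
  by rewrite (le_trans (ler_norm _)) // lerDl sumr_ge0.
rewrite lte_mul_pinfty ?lee_fin ?sumr_ge0 //.
by apply: bounded_lebesgue_lty => //; case: hO.
Qed.

End integration.

(** * Elements and boundary of a meshed domain *)

Section mesh_geometry.
Context {R : realType} {d : nat}.
Variables (Omega : set 'rV[R]_d) (M : mesh R d) (d0 : (0 < d)%N).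
Hypotheses (hO : bounded_domain Omega) (hM : fe_partition Omega M).

Let hK (K : 'I_(nelt M)) : affinely_independent (vertex K) :=
  @fe_nondegenerate _ _ _ _ hM K.

Lemma ediam_le_meshsize (K : 'I_(nelt M)) : ediam (elem K) <= meshsize M.
Proof. exact: (le_bigmax _ (fun K : 'I_(nelt M) => ediam (elem K)) K). Qed.

(** A mesh vertex whose first coordinate is largest has the largest first
coordinate in the whole closure, so no neighbourhood of it lies in [Omega]. *)
Lemma boundary_nonempty : boundary Omega !=set0.
Proof.
have [oO _ [x0 Ox0] _] := hO; pose i0 := Ordinal d0.
have [K0 _] := sub_closure_elem hM (subset_closure Ox0).
pose j := [arg max_(j > (K0, ord0) : 'I_(nelt M) * 'I_d.+1) vertex j.1 j.2 ord0 i0]%O.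
have jmax (K : 'I_(nelt M)) i : vertex K i ord0 i0 <= vertex j.1 j.2 ord0 i0.
  by rewrite /j; case: Order.TotalTheory.arg_maxP => // l _ /(_ (K, i) isT).
exists (vertex j.1 j.2); rewrite (boundaryE hO); split.
  by apply: (elem_sub_closure hM (K := j.1)); exact: (vertex_simplex (@hK _)).
move=> /(open_cube_sub oO)[e e0 eO].
pose y : 'rV[R]_d := vertex j.1 j.2 + (e / 2) *: delta_mx ord0 i0.
have /eO /subset_closure /(sub_closure_elem hM)[K Ky] : cube (vertex j.1 j.2) e y.
  move=> i; rewrite !mxE in_itv /=.
  by case: eqP => _; rewrite ?mulr1 ?mulr0; apply/andP; split; lra.
suff : y ord0 i0 <= vertex j.1 j.2 ord0 i0 by rewrite !mxE !eqxx mulr1; lra.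
rewrite -[y](baryK (@hK K)) summxE.
apply: (@le_trans _ _ (\sum_i bary (vertex K) y i * vertex j.1 j.2 ord0 i0)).
  apply: ler_sum => i _; rewrite mxE ler_wpM2l //.
  by move: Ky; rewrite /elem (simplexE (@hK K)); exact.
by rewrite -mulr_suml (sum_bary (@hK K)) mul1r.
Qed.

(** The interior of an element is open and consists of adherent points of
[Omega]. *)
Lemma open_simplex_meets_domain (K : 'I_(nelt M)) :
  Omega `&` open_simplex (vertex K) !=set0.
Proof.
have [x Kx] := open_simplex_nonempty (@hK K).
have cx : closure Omega x.
  exact: (elem_sub_closure hM (sub_open_simplex (@hK K) Kx)).
apply: (cx (open_simplex (vertex K))); apply: open_nbhs_nbhs; split => //.
exact: (@open_simplex_open _ _ (vertex K)).
Qed.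

Lemma grad_open_simplex (K : 'I_(nelt M)) (v : 'rV[R]_d -> R) q r x :
  (forall y, elem K y -> v y = vdot q y + r) ->
  open_simplex (vertex K) x -> grad v x = q.
Proof.
move=> vE; apply: grad_affine (@open_simplex_open _ _ (vertex K)) => y Ky.
by apply: vE; exact: (sub_open_simplex (@hK K)).
Qed.

Lemma affine_on_elem_bounded (K : 'I_(nelt M)) q r :
  exists C, forall x, elem K x -> `|vdot q x + r| <= C.
Proof.
exists (\sum_i `|vdot q (vertex K i) + r|) => x Kx.
rewrite (bary_affine_fun (@hK K)); apply: le_trans (ler_norm_sum _ _ _) _.
apply: ler_sum => i _; rewrite normrM ler_piMl // ger0_norm.
  exact: (bary_le1 (@hK K)).
by move: Kx; rewrite /elem (simplexE (@hK K)); exact.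
Qed.

End mesh_geometry.

(** * The integrand of the form *)

Section integrand.
Context {R : realType} {d : nat}.
Variables (Omega : set 'rV[R]_d) (M : mesh R d) (d0 : (0 < d)%N).
Hypotheses (hO : bounded_domain Omega) (hM : fe_partition Omega M).
Variables (a : 'rV[R]_d -> R -> 'rV[R]_d -> R)
  (b : 'rV[R]_d -> R -> 'rV[R]_d -> 'rV[R]_d) (c : 'rV[R]_d -> R -> R).
Variables (lambda Lambda nu : R) (hlambda : 0 < lambda) (hnu : 0 <= nu).
Hypotheses (hbounded : forall x eta q, Omega x -> `|a x eta q| <= Lambda)
  (hlower : forall x eta q, Omega x ->
     lambda ^- 2 * (\sum_i `|b x eta q ord0 i| ^+ 2)
       + lambda ^- 2 * `|c x eta| ^+ 2 <= nu ^+ 2).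

Definition integrand (w u v : 'rV[R]_d -> R) (x : 'rV[R]_d) : R :=
  a x (w x) (grad w x) * vdot (grad u x) (grad v x)
  + vdot (b x (w x) (grad w x)) (grad u x) * v x
  + c x (w x) * u x * v x.

Let coefficients_bound x eta q : Omega x ->
  vdot (b x eta q) (b x eta q) + c x eta ^+ 2 <= (lambda * nu) ^+ 2.
Proof.
move=> /(hlower eta q); rewrite -mulrDr mulrC ler_pdivrMr ?exprn_gt0 //.
rewrite exprMn mulrC real_normK ?num_real //; congr (_ + _ <= _).
by apply: eq_bigr => i _; rewrite real_normK ?num_real // expr2.
Qed.

Lemma convection_bound x eta q : Omega x -> enorm (b x eta q) <= lambda * nu.
Proof.
move=> Ox; rewrite -(@ler_pXn2r _ 2) ?nnegrE ?enorm_ge0 ?mulr_ge0 ?(ltW hlambda) //.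
rewrite sqr_enorm; apply: le_trans _ (coefficients_bound eta q Ox).
by rewrite lerDl sqr_ge0.
Qed.

Lemma reaction_bound x eta : Omega x -> `|c x eta| <= lambda * nu.
Proof.
move=> Ox; rewrite -(@ler_pXn2r _ 2) ?nnegrE ?mulr_ge0 ?(ltW hlambda) //.
rewrite real_normK ?num_real //; apply: le_trans _ (coefficients_bound eta 0 Ox).
by rewrite lerDr vdot_ge0.
Qed.

(** On the interior of an element the integrand combines the bounded coefficients
with constants and bounded affine functions. *)
Lemma integrand_integrable w u v : measurable_coefficients Omega a b c w ->
  (forall K : 'I_(nelt M), affine_on (elem K) u) ->
  (forall K : 'I_(nelt M), affine_on (elem K) v) ->
  Rd_integrable Omega (integrand w u v).
Proof.
move=> [ma mb mc] hu hv.
have mO := measurable_domain hO hM.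
have hK (K : 'I_(nelt M)) : affinely_independent (vertex K).
  exact: (@fe_nondegenerate _ _ _ _ hM K).
apply: (@elementwise_integrable _ _ _ M) => // K; have [qu [ru uE]] := hu K;
  have [qv [rv vE]] := hv K; pose D := Omega `&` open_simplex (vertex K).
  have DO : D `<=` Omega by move=> x [].
  have mD : measurable (D : set (Rd_leb R d)).
    by apply: measurableI => //; exact: (@measurable_open_simplex _ _ (vertex K)).
  apply: (@eq_measurable_fun _ _ (Rd_leb R d) (measurableTypeR R) _
    (fun x => a x (w x) (grad w x) * vdot qu qv
      + (\sum_i b x (w x) (grad w x) ord0 i * qu ord0 i) * (vdot qv x + rv)
      + c x (w x) * (vdot qu x + ru) * (vdot qv x + rv))).
    move=> x /set_mem[Ox Kx]; have Kx' := sub_open_simplex (@hK K) Kx.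
    by rewrite /integrand (grad_open_simplex hM uE) // (grad_open_simplex hM vE) // uE // vE.
  apply: measurable_funD; first apply: measurable_funD.
  - by apply: measurable_funM => //; exact: measurable_funS ma.
  - apply: measurable_funM; last exact: measurable_affine.
    apply: measurable_sum => i; apply: measurable_funM => //.
    exact: measurable_funS (mb i).
  - apply: measurable_funM; last exact: measurable_affine.
    apply: measurable_funM; last exact: measurable_affine.
    exact: measurable_funS mc.
have [Cu hCu] := affine_on_elem_bounded hM K qu ru.
have [Cv hCv] := affine_on_elem_bounded hM K qv rv.
exists (Lambda * `|vdot qu qv| + lambda * nu * enorm qu * Cv + lambda * nu * Cu * Cv).
move=> x Ox Kx; have Kx' := sub_open_simplex (@hK K) Kx.
rewrite /integrand (grad_open_simplex hM uE) // (grad_open_simplex hM vE) // uE // vE //.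
apply: le_trans (ler_normD _ _) _; apply: lerD.
  apply: le_trans (ler_normD _ _) _; apply: lerD; rewrite normrM.
    by rewrite ler_wpM2r // hbounded.
  apply: ler_pM => //; last exact: hCv.
  apply: le_trans (vdot_le_enorm _ _) _.
  by rewrite ler_wpM2r ?enorm_ge0 // convection_bound.
rewrite !normrM ler_pM ?mulr_ge0 //; last exact: hCv.
by apply: ler_pM => //; [exact: reaction_bound|exact: hCu].
Qed.

(** The diffusion absorbs the convection once the test function is bounded by
[h] times the length of its gradient and [h nu < 1]. *)
Lemma energy_lower_bound x eta q0 (q : 'rV[R]_d) (t h : R) :
  Omega x -> lambda <= a x eta q0 -> 0 <= t -> q = 0 \/ t <= enorm q * h ->
  lambda * (1 - h * nu) * vdot q q
    <= a x eta q0 * vdot q q + vdot (b x eta q0) q * t.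
Proof.
move=> Ox la t0 [->|tq].
  by rewrite vdot0l !mulr0 vdotC vdot0l mul0r addr0.
have : - (lambda * nu * enorm q * (enorm q * h)) <= vdot (b x eta q0) q * t.
  rewrite lerNl -mulNr; apply: le_trans (_ : `|vdot (b x eta q0) q| * t <= _).
    by rewrite ler_wpM2r // -normrN ler_norm.
  apply: ler_pM => //; apply: le_trans (vdot_le_enorm _ _) _.
  by rewrite ler_wpM2r ?enorm_ge0 // convection_bound.
have := ler_wpM2r (vdot_ge0 q) la; rewrite -sqr_enorm.
set e := enorm q => h1 h2.
rewrite (_ : _ * _ * e ^+ 2 = lambda * e ^+ 2 - (lambda * nu * e * (e * h))); last by ring.
exact: lerD.
Qed.

End integrand.

(** * The test function *)

(** If [v] vanishes at the vertex [p i], then [v x] is the inner product of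
its gradient with [x - p i]; otherwise [v] is the constant [m] on the simplex, and may be
written with gradient 0. *)
Lemma two_valued_affine {R : realType} {d : nat} (p : 'I_d.+1 -> 'rV[R]_d)
    (v : 'rV[R]_d -> R) (m : R) :
  affinely_independent p -> affine_on (simplex p) v ->
  (forall i, v (p i) = 0 \/ v (p i) = m) ->
  exists q r, (forall x, simplex p x -> v x = vdot q x + r) /\
    (q = 0 \/ forall x, simplex p x -> v x <= enorm q * ediam (simplex p)).
Proof.
move=> hp va v0m; have [[i vi]|v0] := pselect (exists i, v (p i) = 0).
  have [q [r vE]] := va; exists q, r; split => //; right => x px.
  have pi := vertex_simplex hp i.
  rewrite -[v x]subr0 -vi (vE _ px) (vE _ pi) opprD addrACA subrr addr0 -vdotBr.
  apply: le_trans (ler_norm _) _; apply: le_trans (vdot_le_enorm _ _) _.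
  by rewrite ler_wpM2l ?enorm_ge0 // enorm_le_ediam.
exists 0, m; split; last by left.
move=> x px; rewrite (affine_on_bary hp va px) vdot0l add0r.
rewrite (eq_bigr (fun i => bary p x i * m)) => [|i _].
  by rewrite -mulr_suml sum_bary // mul1r.
by case: (v0m i) => [vi|->//]; case: v0; exists i.
Qed.

Section nodal_positive_part.
Context {R : realType} {d : nat}.
Variables (Omega : set 'rV[R]_d) (M : mesh R d).
Hypotheses (hM : fe_partition Omega M).
Variables (u : 'rV[R]_d -> R) (k : R).

Let hK (K : 'I_(nelt M)) : affinely_independent (vertex K) :=
  @fe_nondegenerate _ _ _ _ hM K.

Let v := nodal_pos Omega M u k.

Lemma nodal_pos_vertex (K : 'I_(nelt M)) i :
  v (vertex K i) = if k <= u (vertex K i) then u (vertex K i) - k else 0.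
Proof. by apply: (nodal_posP hM u k).2; exists K, i. Qed.

Lemma nodal_pos_affine (K : 'I_(nelt M)) : affine_on (elem K) v.
Proof. exact: (nodal_posP hM u k).1.2. Qed.

Lemma nodal_pos_ge0 x : closure Omega x -> 0 <= v x.
Proof.
move=> /(sub_closure_elem hM)[K Kx].
rewrite (affine_on_bary (@hK K) (nodal_pos_affine K) Kx).
apply: sumr_ge0 => i _; apply: mulr_ge0.
  by move: Kx; rewrite /elem (simplexE (@hK K)); exact.
by rewrite nodal_pos_vertex; case: ifP => // ku; rewrite subr_ge0.
Qed.

(** Boundary faces are spanned by nodes on the boundary, where the nodal value of
the positive part is 0. *)
Lemma nodal_pos_P1space0 : (forall x, boundary Omega x -> u x <= k) ->
  P1space0 Omega M v.
Proof.
move=> uk; split; first exact: (nodal_posP hM u k).1.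
move=> x /(fe_boundary hM)[K [I [Ix sI]]].
have Kx := sub_face_simplex (@hK K) Ix.
rewrite (affine_on_bary (@hK K) (nodal_pos_affine K) Kx).
apply: big1 => i _; have [iI|iI] := boolP (i \in I); last first.
  move: Ix; rewrite (faceE (@hK K)) => /(_ i)[_ /(_ iI) ->].
  by rewrite mul0r.
have /uk := sI _ (vertex_face (@hK K) iI).
rewrite nodal_pos_vertex; case: ifP => [ku uk'|]; last by rewrite mulr0.
by rewrite (@le_anti _ _ (u (vertex K i)) k) ?ku ?uk' // subrr mulr0.
Qed.

End nodal_positive_part.

(** Otherwise the intermediate value [m / 2] would be attained. *)
Lemma connected_two_valued {R : realType} {T : topologicalType} (A : set T)
    (f : T -> R) (m : R) : connected A -> {within A, continuous f} -> 0 < m ->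
  (forall x, A x -> f x = 0 \/ f x = m) ->
  (exists2 x, A x & f x = 0) -> forall x, A x -> f x = 0.
Proof.
move=> cA cf m0 f0m [x0 Ax0 fx0] x Ax; have [//|fx] := f0m x Ax.
have iv : is_interval (f @` A).
  by apply/connected_intervalP; exact: connected_continuous_connected.
have [y Ay fy] : (f @` A) (m / 2).
  by apply: (iv 0 m); [exists x0|exists x|apply/andP; split; lra].
by have [] := f0m _ Ay; rewrite fy; lra.
Qed.

(** * The discrete maximum principle *)

Theorem theorem3p3 (R : realType) (d : nat) (hd : d = 2%N \/ d = 3%N)
  (Omega : set 'rV[R]_d) (hOmega : bounded_domain Omega)
  (M : mesh R d) (hM : fe_partition Omega M)
  (sigma : R) (hsigma : shape_regular sigma M)
  (a : 'rV[R]_d -> R -> 'rV[R]_d -> R)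
  (b : 'rV[R]_d -> R -> 'rV[R]_d -> 'rV[R]_d)
  (c : 'rV[R]_d -> R -> R)
  (f g Ihg uh : 'rV[R]_d -> R)
  (hIhg : boundary_interpolant Omega M g Ihg)
  (huh : P1space Omega M uh)
  (hmeas : measurable_coefficients Omega a b c uh)
  (hF : forall v, P1space0 Omega M v -> Rd_integrable Omega (fun x => f x * v x))
  (hbc : forall x, boundary Omega x -> uh x = Ihg x)
  (hweak : forall v, P1space0 Omega M v ->
     formQ Omega a b c uh uh v = formF Omega f v)
  (hf : Rd_locally_integrable Omega f)
  (hf0 : {ae @lebesgue_Rd R d, forall x, Omega x -> f x <= 0})
  (lambda Lambda nu : R) (hlambda : 0 < lambda) (hnu : 0 <= nu)
  (helliptic : forall x eta q, Omega x -> lambda <= a x eta q)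
  (hbounded : forall x eta q, Omega x -> `|a x eta q| <= Lambda)
  (hlower : forall x eta q, Omega x ->
     lambda ^- 2 * (\sum_i `|b x eta q ord0 i| ^+ 2)
       + lambda ^- 2 * `|c x eta| ^+ 2 <= nu ^+ 2)
  (kstar : R)
  (hkstar :
     ((forall x eta, Omega x -> 0 <= c x eta) /\
        kstar = sup [set Num.max (Ihg x) 0 | x in boundary Omega]) \/
     ((forall x eta, Omega x -> c x eta = 0) /\
        kstar = sup [set Ihg x | x in boundary Omega]))
  (hQ : forall k, kstar <= k ->
     0 <= formQ Omega a b c uh (nodal_neg Omega M uh k) (nodal_pos Omega M uh k))
  (hh : meshsize M * nu < 1) :
  sup [set uh x | x in Omega] <= kstar.
Proof.
have d0 : (0 < d)%N by case: hd => ->.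
have hK (K : 'I_(nelt M)) : affinely_independent (vertex K).
  exact: (@fe_nondegenerate _ _ _ _ hM K).
have uaff := huh.2; have bE := boundaryE hOmega.
pose unod (j : 'I_(nelt M) * 'I_d.+1) := uh (vertex j.1 j.2).
pose m := \big[Num.max/kstar]_j unod j.
have unod_m j : unod j <= m by exact: le_bigmax.
have kstar_m : kstar <= m by exact: bigmax_ge_id.
have uh_m x : closure Omega x -> uh x <= m.
  move=> /(sub_closure_elem hM)[K Kx].
  rewrite (affine_on_bary (@hK K) (uaff K) Kx).
  apply: (@le_trans _ _ (\sum_i bary (vertex K) x i * m)).
    apply: ler_sum => i _; apply: ler_wpM2l; last exact: (unod_m (K, i)).
    by move: Kx; rewrite /elem (simplexE (@hK K)); exact.
  by rewrite -mulr_suml (sum_bary (@hK K)) mul1r.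
have [x1 Ox1] : Omega !=set0 by case: hOmega.
suff m_le : m <= kstar.
  apply: ge_sup; first by exists (uh x1), x1.
  by move=> _ [x Ox <-]; apply: le_trans m_le; apply/uh_m/subset_closure.
rewrite leNgt; apply/negP => kstar_lt_m.
have uh_kstar x : boundary Omega x -> uh x <= kstar.
  move=> bx; rewrite hbc //; have Ihg_m y : boundary Omega y -> Ihg y <= m.
    by move=> bdy; rewrite -hbc //; apply: uh_m; move: bdy; rewrite bE => -[].
  case: hkstar => -[_ ->].
    apply: (@le_trans _ _ (Num.max (Ihg x) 0)); first by rewrite le_max lexx.
    apply: ub_le_sup; last by exists x.
    exists (Num.max m 0) => _ [y bdy <-].
    by rewrite ge_max !le_max lexx orbT Ihg_m.
  by apply: ub_le_sup; [exists m => _ [y bdy <-]; exact: Ihg_m|exists x].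
have [xb bxb] := boundary_nonempty d0 hOmega hM.
(* If [c >= 0], then [kstar] is a supremum of nonnegative numbers over the nonempty
   boundary; if [c] is zero there is nothing to check. *)
have reaction_sign x eta t : Omega x -> kstar <= t -> 0 <= c x eta * t.
  move=> Ox kt; case: hkstar => [[c0 kE]|[c0 _]]; last by rewrite c0 // mul0r.
  apply: mulr_ge0; first exact: c0.
  apply: le_trans kt; rewrite kE.
  apply: (@le_trans _ _ (Num.max (Ihg xb) 0)); first by rewrite le_max lexx orbT.
  apply: ub_le_sup; last by exists xb.
  exists (Num.max m 0) => _ [y bdy <-]; rewrite ge_max !le_max lexx orbT andbT.
  by rewrite -hbc // uh_m //; move: bdy; rewrite bE => -[].
(* With this choice of [k] a nodal value is either at most [k] or equal to [m]. *)
pose k := \big[Num.max/kstar]_(j | unod j < m) unod j.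
have k_lt_m : k < m by apply: bigmax_lt.
have kstar_k : kstar <= k by exact: bigmax_ge_id.
pose v := nodal_pos Omega M uh k.
pose w := nodal_neg Omega M uh k.
have v_vertex (K : 'I_(nelt M)) i : v (vertex K i) = 0 \/ v (vertex K i) = m - k.
  rewrite /v nodal_pos_vertex //; case: ifP => [ku|_]; last by left.
  have := unod_m (K, i); rewrite le_eqVlt => /orP[/eqP <-|um]; first by right.
  left; apply/eqP; rewrite subr_eq0 eq_le ku andbT.
  exact: (le_bigmax_cond kstar unod (j := (K, i))).
have v_ge0 x : closure Omega x -> 0 <= v x by exact: nodal_pos_ge0.
have v_P1 : P1space0 Omega M v.
  by apply: nodal_pos_P1space0 => // x bx; apply: le_trans kstar_k; exact: uh_kstar.
have v_aff (K : 'I_(nelt M)) : affine_on (elem K) v by exact: nodal_pos_affine.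
have wE x : w x = uh x - k - v x by [].
have w_aff (K : 'I_(nelt M)) : affine_on (elem K) w.
  have [qu [ru uE]] := uaff K; have [qv [rv vE]] := v_aff K.
  exists (qu - qv), (ru - k - rv) => x Kx.
  by rewrite wE uE // vE // vdotBl; ring.
have mO := measurable_domain hOmega hM.
(* Testing with [v] and subtracting the assumption on [(uh - k)_-] leaves the
   integrand [G], in which [uh - w = v + k] multiplies the reaction coefficient. *)
pose G x := integrand a b c uh uh v x - integrand a b c uh w v x.
have iu : Rd_integrable Omega (integrand a b c uh uh v).
  exact: (integrand_integrable d0 hOmega hM hlambda hnu hbounded hlower hmeas).
have iw : Rd_integrable Omega (integrand a b c uh w v).
  exact: (integrand_integrable d0 hOmega hM hlambda hnu hbounded hlower hmeas).
have iG : Rd_integrable Omega G.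
  by have := integrableB mO iu iw; apply: eq_integrable.
have G_le0 : \int[@lebesgue_Rd R d]_(x in Omega) G x <= 0.
  rewrite /G RintegralB // subr_le0; apply: le_trans _ (hQ k kstar_k).
  rewrite -/(formQ Omega a b c uh uh v) hweak //.
  apply: Rintegral_le0_ae => //; first exact: hF.
  apply: (@negligibleS _ _ _ (@lebesgue_Rd R d) _ _ _ hf0) => x [Ox /= fv].
  move=> /(_ Ox) fx; move: fv; rewrite ltNge => /negP; apply.
  by apply: mulr_le0_ge0 => //; apply: v_ge0; exact: subset_closure.
have hnu' : 0 < 1 - meshsize M * nu by rewrite subr_gt0.
have G_ge (K : 'I_(nelt M)) : exists q r, (forall x, elem K x -> v x = vdot q x + r) /\
    forall x, Omega x -> open_simplex (vertex K) x ->
      lambda * (1 - meshsize M * nu) * vdot q q <= G x.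
  have [q [r [vE qv]]] := two_valued_affine (@hK K) (v_aff K) (v_vertex K).
  exists q, r; split => // x Ox Kx; have [qu [ru uE]] := uaff K.
  have wqE y : elem K y -> w y = vdot (qu - q) y + (ru - k - r).
    by move=> Ky; rewrite wE uE // vE // vdotBl; ring.
  have Kx' : elem K x := sub_open_simplex (@hK K) Kx.
  have vx0 : 0 <= v x by apply: v_ge0; exact: subset_closure.
  rewrite /G /integrand (grad_open_simplex hM uE) // (grad_open_simplex hM vE) //.
  rewrite (grad_open_simplex hM wqE) //.
  have q_v : q = 0 \/ v x <= enorm q * meshsize M.
    case: qv => [->|/(_ x Kx') qv]; [by left|right].
    by apply: le_trans qv _; rewrite ler_wpM2l ?enorm_ge0 // ediam_le_meshsize.
  have energy := energy_lower_bound hlambda hnu hlower Ox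
    (helliptic x (uh x) qu Ox) vx0 q_v.
  have vk : kstar <= v x + k by rewrite -[kstar]add0r lerD.
  have reaction := mulr_ge0 (reaction_sign x (uh x) _ Ox vk) vx0.
  move: energy reaction; rewrite vdotBl vdotBr wE; lra.
have G_neg : (@lebesgue_Rd R d).-negligible (Omega `&` [set x | G x < 0]).
  apply: (@negligibleS _ _ _ (@lebesgue_Rd R d) _ _ _ (domain_elem_negligible d0 hM)).
  move=> x [Ox /= Gx]; split => // -[K _ Kx]; have [q [r [_ /(_ x Ox Kx) Gq]]] := G_ge K.
  have := lt_le_trans Gx (le_trans _ Gq); rewrite ltxx => H.
  by apply/notF/H; rewrite !mulr_ge0 ?vdot_ge0 // ltW.
have G_eq0 := Rintegral_le0_ae_eq0 mO iG G_neg G_le0.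
(* A nonzero gradient on an element would make [G] positive on a nonempty open set,
   hence on a set that is not negligible. *)
have v_two_valued x : closure Omega x -> v x = 0 \/ v x = m - k.
  move=> /(sub_closure_elem hM)[K Kx]; have [q [r [vE Gq]]] := G_ge K.
  have q0 : q = 0.
    apply: contrapT => /eqP q0; have oO : open Omega by case: hOmega.
    apply: (open_not_negligible (openI oO (@open_simplex_open _ _ (vertex K)))).
      exact: open_simplex_meets_domain.
    apply: (@negligibleS _ _ _ (@lebesgue_Rd R d) _ _ _ G_eq0) => y [Oy Ky].
    split => //=; rewrite gt_eqF //; apply: lt_le_trans (Gq y Oy Ky).
    rewrite !mulr_gt0 // lt_def vdot_ge0 andbT.
    by apply: contraNN q0 => /eqP /vdot_eq0 ->.
  have -> : v x = v (vertex K ord0).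
    by rewrite !vE ?q0 ?vdot0l //; exact: (vertex_simplex (@hK K)).
  exact: v_vertex.
have v_eq0 : forall x, closure Omega x -> v x = 0.
  have cO : connected Omega by case: hOmega.
  apply: (connected_two_valued (connected_closure cO) v_P1.1.1 _ v_two_valued).
    by rewrite subr_gt0.
  by exists xb; [move: bxb; rewrite bE => -[]|exact: v_P1.2].
(* Since [kstar < m], the maximum [m] is attained at a node. *)
have [j /eqP unod_j] : exists j, unod j == m.
  apply: contrapT => /forallNP unod_neq; suff : m < m by rewrite ltxx.
  by apply: bigmax_lt => // j _; rewrite lt_neqAle unod_m andbT; apply/negP.
have := v_eq0 (vertex j.1 j.2); rewrite /v nodal_pos_vertex // -/(unod j) unod_j.
rewrite (ltW k_lt_m) => /(_ (elem_sub_closure hM (vertex_simplex (@hK _) _))).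
by apply/eqP; rewrite subr_eq0 gt_eqF.
Qed.
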